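(* Let $k$ be a perfect field of characteristic $p>0$, let $n\ge1$, and let $J\subset k[x_1,\ldots,x_n]$ be the radical ideal of a nonempty finite set of $k$-rational points in $\mathbb{A}^n_k$. Let $m\ge1$ be an integer and let $q=p^e$ with an integer $e\ge1$. Then for $M=q(m+n-1)-(n-1)$ one has $$\alpha(J^{(M)})\ge q\,\alpha(J^{(m)})+(q-1)(n-1).$$
   Context: Let $R=k[x_1,\ldots,x_n]$. For distinct points $P_i=(a_{i1},\ldots,a_{in})\in k^n$, $i=1,\ldots,s$, with maximal ideals $\mathfrak m_i=(x_1-a_{i1},\ldots,x_n-a_{in})$, the radical ideal of the set $\{P_1,\ldots,P_s\}$ is $J=\bigcap_{i=1}^s\mathfrak m_i$, and its symbolic powers are $J^{(r)}=\bigcap_{i=1}^s\mathfrak m_i^r$ for $r\ge1$. For a nonzero (not necessarily homogeneous) ideal $L\subseteq R$, the initial degree is $\alpha(L)=\min\{\deg f\mid 0\ne f\in L\}$, where $\deg$ is the total degree. *)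

(* Defs.v *)
From mathcomp Require Import all_boot all_algebra.
From mathcomp Require Import mpoly.
From Stdlib Require Import ClassicalEpsilon.

Set Implicit Arguments.
Unset Strict Implicit.
Unset Printing Implicit Defensive.

Import GRing.Theory.
Local Open Scope ring_scope.

(* Over a field of characteristic p > 0, perfect means k = k^p. *)
Definition perfect (p : nat) (k : fieldType) : Prop :=
  forall x : k, exists y : k, y ^+ p = x.

Section Ideals.
Variable R : comNzRingType.
Implicit Types (S I J : R -> Prop) (f g : R).

Definition ideal_gen S : R -> Prop := fun f =>
  exists2 l : seq (R * R),
    (forall u, u \in l -> S u.2) & f = \sum_(u <- l) u.1 * u.2.

Definition ideal_mul I J : R -> Prop :=
  ideal_gen (fun h => exists f g, [/\ I f, J g & h = f * g]).

Fixpoint ideal_exp I (r : nat) : R -> Prop :=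
  if r is r'.+1 then ideal_mul I (ideal_exp I r') else fun _ => True.

Lemma ideal_gen_sub S f : S f -> ideal_gen S f.
Proof.
move=> Sf; exists [:: (1, f)]; last by rewrite big_seq1 mul1r.
by move=> u; rewrite inE => /eqP ->.
Qed.

Lemma ideal_gen_mull S c f : ideal_gen S f -> ideal_gen S (c * f).
Proof.
case=> l Sl ->; exists [seq (c * u.1, u.2) | u <- l].
  by move=> u /mapP[v /Sl Sv ->].
by rewrite big_map mulr_sumr; apply: eq_bigr => u _; rewrite mulrA.
Qed.

Lemma ideal_exp_mull I r c f : ideal_exp I r f -> ideal_exp I r (c * f).
Proof. by case: r => [|r] //=; apply: ideal_gen_mull. Qed.

Lemma ideal_exp_pow I r f : I f -> ideal_exp I r (f ^+ r).
Proof.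
move=> If; elim: r => [|r IHr] //=.
by apply: ideal_gen_sub; exists f, (f ^+ r); split=> //; rewrite exprS.
Qed.

Lemma ideal_exp1 S f : ideal_exp (ideal_gen S) 1 f <-> ideal_gen S f.
Proof.
split=> [[l Sl ->]|Sf]; last by rewrite -[f]expr1; apply: ideal_exp_pow.
elim: l Sl => [|u l IHl] Sl; first by exists [::]; rewrite ?big_nil.
have [v|l2 Sl2 E2] := IHl; first by move=> vl; apply: Sl; rewrite inE vl orbT.
have [|g [h [Sg _ E]]] := Sl u; first by rewrite inE eqxx.
have [l1 Sl1 E1] : ideal_gen S (u.1 * u.2).
  by rewrite E [g * h]mulrC mulrA; apply: ideal_gen_mull.
exists (l1 ++ l2); last by rewrite big_cat big_cons -E1 -E2.
by move=> w; rewrite mem_cat => /orP[/Sl1|/Sl2].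
Qed.

End Ideals.

Section Points.
Variables (k : fieldType) (n : nat).
Implicit Types (a : 'rV[k]_n) (L : {mpoly k[n]} -> Prop).

Definition point_ideal a : {mpoly k[n]} -> Prop :=
  ideal_gen (fun h => exists i : 'I_n, h = 'X_i - (a 0 i)%:MP).

Definition points_ideal s (P : 'I_s -> 'rV[k]_n) : {mpoly k[n]} -> Prop :=
  fun f => forall i, point_ideal (P i) f.

Definition symbolic_power s (P : 'I_s -> 'rV[k]_n) (r : nat) :
    {mpoly k[n]} -> Prop :=
  fun f => forall i, ideal_exp (point_ideal (P i)) r f.

(* msize f is one more than the total degree of f != 0. *)
Definition tdeg (f : {mpoly k[n]}) : nat := (msize f).-1.

Definition is_initial_degree L (d : nat) : Prop :=
  (exists f, [/\ f != 0, L f & tdeg f = d]) /\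
  (forall f, f != 0 -> L f -> (d <= tdeg f)%N).

(* Arbitrary when L contains no nonzero polynomial; see alphaP. *)
Definition alpha L : nat := epsilon (inhabits 0%N) (is_initial_degree L).

Lemma is_initial_degree_uniq L d d' :
  is_initial_degree L d -> is_initial_degree L d' -> d = d'.
Proof.
move=> [[f [f0 Lf <-]] mf] [[g [g0 Lg <-]] mg].
by apply/eqP; rewrite eqn_leq mf // mg.
Qed.

Lemma alphaP L : (exists2 f, f != 0 & L f) -> is_initial_degree L (alpha L).
Proof.
case=> f f0 Lf; apply: epsilon_spec.
elim/ltn_ind: {f}(tdeg f) {-2}f (erefl (tdeg f)) f0 Lf => d IH f fd f0 Lf.
have [[g [g0 Lg gd]]|nog] :=
  classic (exists g, [/\ g != 0, L g & (tdeg g < d)%N]).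
  exact: (IH _ gd g).
exists d; split; first by exists f.
by move=> g g0 Lg; rewrite leqNgt; apply/negP => gd; apply: nog; exists g.
Qed.

Lemma symbolic_power1 s (P : 'I_s -> 'rV[k]_n) f :
  symbolic_power P 1 f <-> points_ideal P f.
Proof. by split=> H i; apply/ideal_exp1/H. Qed.

Lemma symbolic_power_nonzero s (P : 'I_s -> 'rV[k]_n) r :
  (0 < n)%N -> exists2 f, f != 0 & symbolic_power P r f.
Proof.
move=> n0; pose j := Ordinal n0.
exists (\prod_(i < s) ('X_j - (P i 0 j)%:MP) ^+ r).
  apply/prodf_neq0 => i _; apply/expf_neq0/eqP => /(congr1 (mcoeff U_(j)%MM)).
  rewrite mcoeffB mcoeffX eqxx mcoeffC mnm1_eq0 mulr0 subr0 mcoeff0.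
  by move/eqP; rewrite oner_eq0.
move=> i; rewrite (bigD1 i) //= mulrC; apply/ideal_exp_mull/ideal_exp_pow.
by apply: ideal_gen_sub; exists j.
Qed.

End Points.

(* Main.v *)
Require Import Defs.
From mathcomp Require Import all_boot all_algebra.
From mathcomp Require Import mpoly.
From mathcomp Require Import zify.

(** The theorem for [q = p ^ e.+1] follows from the theorem for [q = p] and for
    [p ^ e], because [M + n - 1 = q (m + n - 1)]: the passage from [m] to [M]
    composes over the factors of [q], and so do the two bounds. It remains to
    treat [q = p], where [M = p m + (p - 1)(n - 1)].

    Let [f] be nonzero of least degree in [J^(M)] and differentiate it as long
    as some partial derivative is nonzero. A variable can be used at most
    [p - 1] times, because [p] derivatives in one variable give 0, so this
    stops after [t <= n (p - 1)] steps. All partial derivatives of the result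
    vanish; the field being perfect, the result is a power [g ^+ p]. Each
    derivative lowers the degree by at least 1 and the order of vanishing at
    the points by at most 1, so [p deg g + t <= deg f] and [g ^+ p] lies in
    [J^(M - t)]. The order of vanishing of [g ^+ p] at a point is [p] times
    that of [g], hence [g] lies in [J^(m + w)], where [w] is
    [((p - 1)(n - 1) - t) / p] rounded up, or 0 if [t > (p - 1)(n - 1)]; the
    second case is where [t <= n (p - 1)] matters, giving [M - t > p (m - 1)].
    If [alpha (J^(m + w)) >= alpha (J^(m)) + w], then
    [deg f >= t + p alpha (J^(m)) + p w >= p alpha (J^(m)) + (p - 1)(n - 1)].

    That [alpha (J^(r))] grows strictly with [r] is clear in characteristic 0,
    where a partial derivative of an element of [J^(r + 1)] is an element of
    [J^(r)] of smaller degree. Here the same argument works unless the element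
    is a power [g ^+ p], and then induction on the degree replaces one of the
    [p] factors [g] by a polynomial of smaller degree that vanishes to one
    order less ([exists_lower_degree]).

    Orders of vanishing are read off the coefficients of [f (X + a)]
    ([ideal_exp_point_idealP]); this makes [p]-th powers tractable, while
    derivatives are handled by the Leibniz rule in the ideal powers. *)

Set Implicit Arguments.
Unset Strict Implicit.
Unset Printing Implicit Defensive.

Import GRing.Theory.

(** * Powers of ideals *)

Section IdealPowers.
Local Open Scope ring_scope.
Variable R : comNzRingType.
Implicit Types (S I : R -> Prop) (f g : R) (r s : nat).

Lemma ideal_gen0 S : ideal_gen S 0.
Proof. by exists [::]; rewrite ?big_nil. Qed.

Lemma ideal_genD S f g : ideal_gen S f -> ideal_gen S g -> ideal_gen S (f + g).
Proof.
case=> l Sl -> [l' Sl' ->]; exists (l ++ l'); last by rewrite big_cat.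
by move=> u; rewrite mem_cat => /orP[/Sl|/Sl'].
Qed.

Lemma ideal_gen_ind S (Q : R -> Prop) :
    Q 0 -> (forall f g, Q f -> Q g -> Q (f + g)) ->
    (forall c h, S h -> Q (c * h)) ->
  forall f, ideal_gen S f -> Q f.
Proof.
move=> Q0 QD QM _ [l Sl ->]; rewrite big_seq; apply: big_ind => // u ul.
by apply: QM; apply: Sl.
Qed.

Lemma ideal_exp0 I r : ideal_exp I r 0.
Proof. by case: r => // r; apply: ideal_gen0. Qed.

Lemma ideal_expD I r f g :
  ideal_exp I r f -> ideal_exp I r g -> ideal_exp I r (f + g).
Proof. by case: r => // r; apply: ideal_genD. Qed.

Lemma ideal_expSM I r f g : I f -> ideal_exp I r g -> ideal_exp I r.+1 (f * g).
Proof. by move=> If Ig; apply: ideal_gen_sub; exists f, g. Qed.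

Lemma ideal_expM I r s f g :
  ideal_exp I r f -> ideal_exp I s g -> ideal_exp I (r + s) (f * g).
Proof.
elim: r f g => [|r IHr] f g /=; first by move=> _; apply: ideal_exp_mull.
move=> If Ig; move: f If; apply: ideal_gen_ind => [|f f' IHf IHf'|c h].
- by rewrite mul0r; apply: ideal_gen0.
- by rewrite mulrDl; apply: ideal_genD.
move=> [f [f' [If If' ->]]]; rewrite -!mulrA; apply: ideal_gen_mull.
by apply: ideal_gen_sub; exists f, (f' * g); split=> //; apply: IHr.
Qed.

Lemma ideal_expX I r j f : ideal_exp I r f -> ideal_exp I (j * r) (f ^+ j).
Proof.
move=> If; elim: j => [|j IHj] //.
by rewrite exprS mulSn; apply: ideal_expM.
Qed.

Lemma ideal_exp_leq I r s f : (s <= r)%N -> ideal_exp I r f -> ideal_exp I s f.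
Proof.
move=> /subnK <-; elim: (r - s)%N f => [|d IHd] f; first by rewrite add0n.
rewrite addSn /=; move: f; apply: ideal_gen_ind => [|f g|c h [f [g [_ Ig ->]]]].
- exact: ideal_exp0.
- exact: ideal_expD.
by rewrite mulrA; apply/ideal_exp_mull/IHd.
Qed.

End IdealPowers.

(** * Derivatives and degrees of polynomials *)

Section Polynomials.
Local Open Scope ring_scope.
Variables (k : fieldType) (n : nat).
Implicit Types (f g : {mpoly k[n]}) (a : 'rV[k]_n) (r s : nat).

(** Leibniz rule: in a product of [r + 1] factors from [I] only one of them is
    differentiated, and the other [r] still lie in [I]. *)
Lemma ideal_exp_mderiv (I : {mpoly k[n]} -> Prop) i r f :
  ideal_exp I r.+1 f -> ideal_exp I r f^`M(i).
Proof.
elim: r f => [|r IHr] // f.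
move: f; apply: ideal_gen_ind => [|f g|c h [f [g [If Ig ->]]]].
- by rewrite mderiv0; apply: ideal_exp0.
- by rewrite mderivD; apply: ideal_expD.
rewrite mderivM; apply: ideal_expD; last apply: ideal_exp_mull.
  by do 2!apply: ideal_exp_mull.
rewrite mderivM; apply: ideal_expD; first by apply: ideal_exp_mull.
by apply: ideal_expSM => //; apply: IHr.
Qed.

Lemma tdeg_mlead f : f != 0 -> tdeg f = mdeg (mlead f).
Proof. by move=> f0; rewrite /tdeg -mlead_deg. Qed.

Lemma mdeg_le_tdeg f u : f@_u != 0 -> (mdeg u <= tdeg f)%N.
Proof. by rewrite -mcoeff_msupp /tdeg => /msize_mdeg_lt; lia. Qed.

Lemma tdegM f g : f != 0 -> g != 0 -> tdeg (f * g) = (tdeg f + tdeg g)%N.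
Proof.
by move=> f0 g0; rewrite !tdeg_mlead ?mulf_neq0 // mleadM // mdegD.
Qed.

Lemma tdegX f j : f != 0 -> tdeg (f ^+ j) = (j * tdeg f)%N.
Proof.
by move=> f0; rewrite !tdeg_mlead ?expf_neq0 // mleadX // mdegMn mulnC.
Qed.

Lemma tdeg_mderiv i f : f^`M(i) != 0 -> (tdeg f^`M(i) < tdeg f)%N.
Proof.
move=> df0; rewrite (tdeg_mlead df0).
have: f@_(mlead f^`M(i) + U_(i)) != 0.
  apply: contra_neq df0 => z; apply/eqP.
  by rewrite -mleadc_eq0 mcoeff_mderiv z mul0rn.
by move/mdeg_le_tdeg; rewrite mdegD mdeg1 addn1.
Qed.

(** * The order of vanishing at a point *)

(** Membership in the [r]-th power of the maximal ideal of the origin, in terms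
    of coefficients. *)
Definition vanishes_to r g := forall u, (mdeg u < r)%N -> g@_u = 0.

Lemma vanishes_toM r s f g :
  vanishes_to r f -> vanishes_to s g -> vanishes_to (r + s) (f * g).
Proof.
move=> vf vg u lt_u; rewrite mcoeffM big1 // => -[v w] /= /eqP E.
have [/vf ->|le_r] := ltnP (mdeg v) r; first by rewrite mul0r.
rewrite vg ?mulr0 //; move/(congr1 mdeg): E; rewrite mdegD => E.
by rewrite -(ltn_add2l (mdeg v)) -E (leq_trans lt_u) ?leq_add2r.
Qed.

Definition shift a f := f \mPo [tuple 'X_i + (a 0 i)%:MP | i < n].

Lemma shiftXU a i : shift a 'X_i = 'X_i + (a 0 i)%:MP.
Proof. by rewrite /shift comp_mpolyXU -tnth_nth tnth_mktuple. Qed.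

Lemma shiftX a u : shift a 'X_[u] = \prod_(i < n) ('X_i + (a 0 i)%:MP) ^+ u i.
Proof.
by rewrite /shift comp_mpolyX; apply: eq_bigr => i _; rewrite tnth_mktuple.
Qed.

Lemma shiftK a f : shift (- a) (shift a f) = f.
Proof.
rewrite [in shift a f]/shift comp_mpolyEX [LHS]raddf_sum [RHS]mpolyE /=.
apply: eq_bigr => u _; rewrite [LHS]comp_mpolyZ; congr (_ *: _).
rewrite -/(shift a _) shiftX rmorph_prod mpolyXE_id; apply: eq_bigr => i _.
rewrite rmorphXn rmorphD /= -/(shift (- a) _) shiftXU comp_mpolyC mxE mpolyCN.
by rewrite subrK.
Qed.

(** For the converse, expand [f] at [a] (Taylor): a product of [u i] copies of
    each [X_i - a_i] lies in the power [mdeg u] of the maximal ideal. *)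
Lemma ideal_exp_point_idealP a r f :
  ideal_exp (point_ideal a) r f <-> vanishes_to r (shift a f).
Proof.
split.
  elim: r f => [|r IHr] //= f.
  move: f; apply: ideal_gen_ind => [u _|f g vf vg u ltu|c h [f [g [If Ig ->]]]].
  - by rewrite /shift comp_mpoly0 mcoeff0.
  - by rewrite /shift comp_mpolyD mcoeffD vf ?vg ?addr0.
  rewrite /shift !rmorphM /= -!/(shift a _).
  apply: (@vanishes_toM 0 r.+1) => //.
  apply: (@vanishes_toM 1 r); last exact: IHr.
  move: f If; apply: ideal_gen_ind => [u _|f f' vf vf' u ltu|d h' [i ->]].
  - by rewrite /shift comp_mpoly0 mcoeff0.
  - by rewrite /shift comp_mpolyD mcoeffD vf ?vf' ?addr0.
  rewrite /shift rmorphM rmorphB /= -!/(shift a _) shiftXU.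
  rewrite [shift a _%:MP]comp_mpolyC addrK.
  apply: (@vanishes_toM 0 1) => // u.
  rewrite ltnS leqn0 mdeg_eq0 => /eqP ->.
  by rewrite mcoeffX mnm1_eq0.
move=> vf; rewrite -(shiftK a f) [shift a f]mpolyE [shift (- a) _]raddf_sum /=.
rewrite big_seq; apply: big_ind => [|g h|u].
- exact: ideal_exp0.
- exact: ideal_expD.
rewrite mcoeff_msupp => fu0; rewrite comp_mpolyZ -mul_mpolyC.
have le_ru : (r <= mdeg u)%N.
  by rewrite leqNgt; apply: contra_neqN fu0; apply: vf.
apply/ideal_exp_mull/(ideal_exp_leq le_ru).
rewrite -/(shift _ _) shiftX mdegE.
apply: (big_ind2 (fun h d => ideal_exp (point_ideal a) d h)) => //.
  by move=> h d h' d'; apply: ideal_expM.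
move=> i _; apply/ideal_exp_pow/ideal_gen_sub; exists i.
by rewrite mxE mpolyCN.
Qed.

End Polynomials.

(** * Polynomials in characteristic p *)

Section Frobenius.
Local Open Scope ring_scope.
Variables (k : fieldType) (p : nat).
Hypothesis hp : p \in [pchar k].
Variable n : nat.
Implicit Types (f g : {mpoly k[n]}) (a : 'rV[k]_n) (r s : nat).

Let p_prime : prime p := pcharf_prime hp.

Lemma pchar_mpoly : p \in [pchar {mpoly k[n]}].
Proof. exact: (rmorph_pchar (mpolyC n (R := k))). Qed.

Lemma mpoly_Frobenius (l : seq 'X_{1..n}) (c : 'X_{1..n} -> k)
    (d : 'X_{1..n} -> 'X_{1..n}) :
  (\sum_(u <- l) c u *: 'X_[d u]) ^+ p
  = \sum_(u <- l) c u ^+ p *: 'X_[d u *+ p].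
Proof.
rewrite -(pFrobenius_autE pchar_mpoly) rmorph_sum; apply: eq_bigr => u _.
by rewrite /= pFrobenius_autE exprZn mpolyXn.
Qed.

Lemma mcoeff_Frobenius g u : (g ^+ p)@_(u *+ p) = g@_u ^+ p.
Proof.
have inj v : ((v *+ p)%MM == (u *+ p)%MM) = (v == u).
  apply/eqP/eqP => [E|-> //]; apply/mnmP => i.
  move/mnmP/(_ i): E; rewrite !mulmnE => /eqP.
  by rewrite eqn_pmul2r ?prime_gt0 // => /eqP.
rewrite [in LHS](mpolyE g) mpoly_Frobenius raddf_sum /=.
under eq_bigr do rewrite mcoeffZ mcoeffX inj.
have [gu|gu] := boolP (u \in msupp g).
  rewrite (bigD1_seq u) //= eqxx mulr1 big1 ?addr0 // => v /negPf ->.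
  by rewrite mulr0.
rewrite (memN_msupp_eq0 gu) expr0n gtn_eqF ?prime_gt0 // big1_seq // => v /= gv.
by case: eqP gv gu => [-> ->|_] //; rewrite mulr0.
Qed.

(** The coefficient of [X^u] in [f], times [u i], is a coefficient of the
    [i]-th derivative; hence [p] divides every exponent that occurs in [f], and
    the coefficients have [p]-th roots. *)
Lemma mderivs_eq0_Frobenius f : perfect p k ->
  (forall i, f^`M(i) = 0) -> exists g, f = g ^+ p.
Proof.
move=> hk df0.
have root_ex (x : k) : exists y, y ^+ p == x by have [y <-] := hk x; exists y.
exists (\sum_(u <- msupp f)
  xchoose (root_ex f@_u) *: 'X_[[multinom u i %/ p | i < n]]).
rewrite mpoly_Frobenius {1}(mpolyE f); apply: eq_big_seq => u.
rewrite mcoeff_msupp => fu0; rewrite (eqP (xchooseP (root_ex _))); congr (_ *: 'X_[_]).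
apply/mnmP => i; rewrite mulmnE mnmE divnK //.
have [->//|ui0] := eqVneq (u i) 0%N.
have := mcoeff_mderiv i f (u - U_(i)); rewrite df0 mcoeff0 submK ?lep1mP //.
rewrite mnmBE mnm1E eqxx subn1 prednK ?lt0n // -mulr_natr.
by move/esym/eqP; rewrite mulf_eq0 (negPf fu0) /= (dvdn_pcharf hp).
Qed.

(** The factor [x ^_ (u i)] of a coefficient of the derivative is a multiple of
    [(u i)`!], hence of [p] if [u i >= p]. *)
Lemma mderivm_neq0_lt f u i : f^`M[u] != 0 -> (u i < p)%N.
Proof.
apply: contra_neqT; rewrite -leqNgt => le_p; apply/mpolyP => v.
rewrite mcoeff_mderivm mcoeff0 (bigD1 i) //= -mulr_natr natrM.
suff /eqP -> : (((u + v)%MM i) ^_ (u i))%:R == 0 :> k by rewrite mul0r mulr0.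
rewrite -(dvdn_pcharf hp) -bin_ffact; apply/dvdn_mull/dvdn_fact.
by rewrite prime_gt0.
Qed.

(** After translating [a] to the origin, the coefficients of [g ^+ p] are the
    [p]-th powers of those of [g], in [p] times the degree. Thus [g] vanishes to
    order at least [s / p] rounded up. *)
Lemma point_ideal_root a r s g :
    (p * r < s + p)%N ->
  ideal_exp (point_ideal a) s (g ^+ p) -> ideal_exp (point_ideal a) r g.
Proof.
move=> lt_rs /ideal_exp_point_idealP vgp; apply/ideal_exp_point_idealP => u ltu.
have := mcoeff_Frobenius (shift a g) u.
rewrite /shift -rmorphXn /= -/(shift a _) vgp => [/esym/eqP|].
  by rewrite expf_eq0 prime_gt0 //= => /eqP.
have : ((mdeg u).+1 * p <= r * p)%N by rewrite leq_mul2r ltu orbT.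
by rewrite mdegMn; lia.
Qed.

End Frobenius.

(** * Symbolic powers and initial degrees *)

Section SymbolicPowers.
Local Open Scope ring_scope.
Variables (k : fieldType) (p : nat).
Hypotheses (hp : p \in [pchar k]) (hk : perfect p k).
Variables (n s : nat) (P : 'I_s -> 'rV[k]_n).
Implicit Types (f g h : {mpoly k[n]}) (r m : nat).

Let p_prime : prime p := pcharf_prime hp.

(** Differentiating as long as possible ends in a [p]-th power; the multi-index
    [u] records the derivatives taken. *)
Lemma exists_mderivm_Frobenius r f : f != 0 -> symbolic_power P r f ->
  exists (u : 'X_{1..n}) g,
    [/\ g != 0, (forall i, u i < p)%N, (p * tdeg g + mdeg u <= tdeg f)%N &
        symbolic_power P (r - mdeg u) (g ^+ p)].
Proof.
move=> f0 Jf; suff [u [g [g0 E le_deg Jg]]] : exists (u : 'X_{1..n}) g,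
    [/\ g != 0, f^`M[u] = g ^+ p, (p * tdeg g + mdeg u <= tdeg f)%N &
        symbolic_power P (r - mdeg u) (g ^+ p)].
  exists u, g; split=> // i; apply: (mderivm_neq0_lt hp (f := f)).
  by rewrite E expf_neq0.
elim/ltn_ind: {f}(tdeg f) {-2}f (erefl (tdeg f)) r f0 Jf => d IH f Ed r f0 Jf.
have [/forallP df0|/forallPn[i df0]] := boolP [forall i, f^`M(i) == 0].
  have [|g E] := mderivs_eq0_Frobenius hp (f := f) hk.
    by move=> i; apply/eqP/df0.
  have g0 : g != 0.
    by apply: contra_neq f0 => g0; rewrite E g0 expr0n gtn_eqF ?prime_gt0.
  exists 0%MM, g; rewrite mderivm0m mdeg0 subn0 addn0 -E; split=> //.
  by rewrite -tdegX // -E Ed.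
have lt_d : (tdeg f^`M(i) < d)%N by rewrite -Ed tdeg_mderiv.
have [||u [g [g0 E le_deg Jg]]] := IH _ lt_d _ erefl r.-1 => //.
  by case: r Jf => [|r] Jf j //; apply: ideal_exp_mderiv.
exists (U_(i) + u)%MM, g; rewrite mderivmDm mderivmU1m mdegD mdeg1; split=> //.
  by rewrite addnCA; lia.
by rewrite subnDA subn1.
Qed.

Lemma symbolic_power_tdeg_gt0 r f : (0 < s)%N -> f != 0 ->
  symbolic_power P r.+1 f -> (0 < tdeg f)%N.
Proof.
move=> hs f0 Jf; rewrite lt0n; apply: contraNN f0 => /eqP d0.
have Ef : f = (f@_0)%:MP by apply: msize1_polyC; move: d0; rewrite /tdeg; lia.
have /ideal_exp_point_idealP/(_ 0%MM) := Jf (Ordinal hs).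
rewrite mdeg0 /shift Ef comp_mpolyC mcoeffC eqxx mulr1.
by move=> ->.
Qed.

(** If a partial derivative of [f] is nonzero, that derivative will do.
    Otherwise [f = g ^+ p]; with [d = r %/ p] the polynomial [g] lies in
    [J^(d + 1)], so by induction there is [h] in [J^(d)] of degree less than
    [deg g], and [g ^+ (p - 1) * h] lies in
    [J^((p - 1)(d + 1) + d)], where [(p - 1)(d + 1) + d >= r]. *)
Lemma exists_lower_degree r f : (0 < s)%N -> f != 0 ->
    symbolic_power P r.+1 f ->
  exists h, [/\ h != 0, symbolic_power P r h & (tdeg h < tdeg f)%N].
Proof.
move=> hs f0 Jf.
elim/ltn_ind: {f}(tdeg f) {-2}f (erefl (tdeg f)) r f0 Jf => D IH f ED r f0 Jf.
have [/forallP df0|/forallPn[i df0]] := boolP [forall i, f^`M(i) == 0];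
  last first.
  exists f^`M(i); split=> //; last by apply: tdeg_mderiv.
  by move=> j; apply: ideal_exp_mderiv.
have [|g E] := mderivs_eq0_Frobenius hp (f := f) hk.
  by move=> i; apply/eqP/df0.
have p_gt1 := prime_gt1 p_prime.
have g0 : g != 0.
  by apply: contra_neq f0 => g0; rewrite E g0 expr0n gtn_eqF ?prime_gt0.
have Er := divn_eq r p; have lt_p := ltn_pmod r (ltnW p_gt1).
set d := (r %/ p)%N in Er.
have Jg : symbolic_power P d.+1 g.
  move=> i; apply: (point_ideal_root hp (s := r.+1)); last first.
    by rewrite -E; apply: Jf.
  by rewrite mulnS mulnC; lia.
have g_gt0 := symbolic_power_tdeg_gt0 hs g0 Jg.
have Edeg : D = (p * tdeg g)%N by rewrite -ED E tdegX.
have [|h [h0 Jh lt_h]] := IH (tdeg g) _ g erefl d g0 Jg.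
  by rewrite Edeg ltn_Pmull.
exists (g ^+ p.-1 * h); split.
- by rewrite mulf_neq0 ?expf_neq0.
- move=> i; apply: (ideal_exp_leq (r := p.-1 * d.+1 + d)); last first.
    by apply: ideal_expM (Jh i); apply: ideal_expX.
  have : (d * p = p.-1 * d + d)%N.
    by rewrite mulnC -{1}(prednK (ltnW p_gt1)) mulSn addnC.
  by rewrite mulnS; lia.
have : (p * tdeg g = tdeg g + p.-1 * tdeg g)%N.
  by rewrite -{1}(prednK (ltnW p_gt1)) mulSn.
by rewrite tdegM ?expf_neq0 // tdegX // ED Edeg; lia.
Qed.

Hypotheses (hn : (0 < n)%N) (hs : (0 < s)%N).

Local Notation alphaJ r := (alpha (symbolic_power P r)).

Lemma alpha_attained r :
  exists f, [/\ f != 0, symbolic_power P r f & tdeg f = alphaJ r].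
Proof. by have [] := alphaP (symbolic_power_nonzero P r hn). Qed.

Lemma alpha_le_tdeg r f :
  f != 0 -> symbolic_power P r f -> (alphaJ r <= tdeg f)%N.
Proof. by have [_] := alphaP (symbolic_power_nonzero P r hn); apply. Qed.

Lemma alpha_addn r w : (alphaJ r + w <= alphaJ (r + w))%N.
Proof.
elim: w => [|w IHw]; first by rewrite !addn0.
have [f [f0 Jf <-]] := alpha_attained (r + w.+1).
rewrite addnS in Jf; have [h [h0 Jh lt_h]] := exists_lower_degree hs f0 Jf.
by rewrite addnS (leq_trans _ lt_h) // ltnS (leq_trans IHw) // alpha_le_tdeg.
Qed.

(** The [mdeg u] derivatives cost that much of the order [p m + c] and gain that
    much in degree. If they use up less than [c], the rest of [c] stays in the
    order of vanishing of [g], and [alpha_addn] turns it into degree. *)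
Lemma alpha_Frobenius m :
  (p * alphaJ m + p.-1 * n.-1 <= alphaJ (p * m + p.-1 * n.-1))%N.
Proof.
set c := (p.-1 * n.-1)%N.
have [f [f0 Jf <-]] := alpha_attained (p * m + c).
have [u [g [g0 lt_up le_deg Jg]]] := exists_mderivm_Frobenius f0 Jf.
have p_gt0 := prime_gt0 p_prime.
have le_u : (mdeg u <= c + p.-1)%N.
  rewrite /c addnC -mulnS (prednK hn) mdegE mulnC.
  rewrite -[X in (_ <= X * _)%N]card_ord -sum_nat_const; apply: leq_sum => i _.
  by rewrite -ltnS (prednK p_gt0).
(* w is (c - mdeg u) / p rounded up, with a truncated difference. *)
pose w := ((c - mdeg u + p.-1) %/ p)%N.
have Ew := divn_eq (c - mdeg u + p.-1) p.
have lt_w := ltn_pmod (c - mdeg u + p.-1) p_gt0.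
rewrite -/w [(w * p)%N]mulnC in Ew.
have Jg' : symbolic_power P (m + w) g.
  move=> i; apply: (point_ideal_root hp) (Jg i).
  have [le_uc|lt_cu] := leqP (mdeg u) c; first by rewrite mulnDr; lia.
  have -> : w = 0%N by rewrite /w divn_small //; lia.
  by rewrite addn0; lia.
have le_g := leq_trans (alpha_addn m w) (alpha_le_tdeg g0 Jg').
have : (p * alphaJ m + p * w <= p * tdeg g)%N.
  by rewrite -mulnDr leq_mul2l le_g orbT.
by lia.
Qed.

(** The map [m |-> p m + (p - 1)(n - 1)] is multiplication by [p] on
    [m + (n - 1)], so its iterates have the same form with [p ^ e] for [p]. *)
Lemma alpha_Frobenius_iter m e :
  (p ^ e * alphaJ m + (p ^ e).-1 * n.-1
     <= alphaJ (p ^ e * m + (p ^ e).-1 * n.-1))%N.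
Proof.
elim: e => [|e IHe]; first by rewrite expn0 !mul1n !mul0n !addn0.
set q := (p ^ e)%N in IHe *; have p_gt0 := prime_gt0 p_prime.
have q_gt0 : (0 < q)%N by rewrite expn_gt0 p_gt0.
have E x : (p ^ e.+1 * x + (p ^ e.+1).-1 * n.-1
    = p * (q * x + q.-1 * n.-1) + p.-1 * n.-1)%N.
  by rewrite expnS -/q -(prednK q_gt0) -(prednK p_gt0); nia.
rewrite !E; apply: leq_trans (alpha_Frobenius _).
by rewrite leq_add2r leq_mul2l IHe orbT.
Qed.

End SymbolicPowers.

Theorem theorem5p1 (k : fieldType) (p : nat) (hp : p \in [pchar k]%R)
    (hk : perfect p k)
    (n : nat) (hn : 0 < n)
    (s : nat) (hs : 0 < s) (P : 'I_s -> 'rV[k]_n) (hP : injective P)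
    (m : nat) (hm : 0 < m)
    (e : nat) (he : 0 < e) (q : nat) (hq : q = p ^ e)
    (M : nat) (hM : M = q * (m + n - 1) - (n - 1)) :
  q * alpha (symbolic_power P m) + (q - 1) * (n - 1)
    <= alpha (symbolic_power P M).
Proof.
have q_gt0 : 0 < q by rewrite hq expn_gt0 (prime_gt0 (pcharf_prime hp)).
have -> : M = q * m + (q - 1) * (n - 1).
  by rewrite hM -addnBA // mulnDr mulnBl mul1n addnBA // leq_pmull.
by rewrite hq !subn1; apply: alpha_Frobenius_iter.
Qed.
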